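(* Let $d \geq 2$ be an integer, let $X \subseteq [0,1)^d$ be constructed from a $d$-dimensional weak $M$-Latin hypercube $\mathcal{H}$ (i.e. $X = \frac1M\mathcal{H}$), and let $N = \#X = M^{d-1}$. Then $$ L_2^{\mathrm{per}}(X) \geq \left(\frac{d}{2\cdot 3^d}\right)^{1/2} N^{\frac{d-2}{d-1}} $$ and $$ L_2^{\mathrm{extr}}(X) \geq \left(\frac{d}{12^d}\right)^{1/2} (1-o(1)) \cdot N^{\frac{d-2}{d-1}}, $$ where $o(1)$ denotes a quantity depending only on $d$ and $N$ which, for fixed $d$, tends to $0$ as $N \to \infty$.
   Context: A weak $M$-Latin hypercube of dimension $d$ ($M \geq 1$) is a subset $\mathcal{H} \subseteq \{0,1,\dots,M-1\}^d$ such that for any $k \in \{1,\dots,d\}$ and any $m_1,\dots,m_{k-1},m_{k+1},\dots,m_d \in \{0,\dots,M-1\}$ there is exactly one $m_k \in \{0,\dots,M-1\}$ with $(m_1,\dots,m_d) \in \mathcal{H}$. The point set constructed from $\mathcal{H}$ is $\frac1M \mathcal{H} \subseteq [0,1)^d$. For $x, y \in [0,1)$ the (periodic) interval is $[x,y) = \{z \in [0,1): x \leq z < y\}$ if $x<y$, and $[x,y) = \{z \in [0,1): x \leq z \text{ or } z < y\}$ if $x \geq y$. For $\mathbf{x} = (x_1,\dots,x_d), \mathbf{y} = (y_1,\dots,y_d) \in [0,1)^d$ put $[\mathbf{x},\mathbf{y}) = \prod_{k=1}^d [x_k,y_k)$ and let $|[\mathbf{x},\mathbf{y})|$ be its Lebesgue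 measure, i.e. the product over $k$ of $y_k - x_k$ if $x_k<y_k$ and of $1-x_k+y_k$ if $x_k \geq y_k$. For a finite set $X \subseteq [0,1)^d$ with $\#X = N$ the discrepancy function is $D_X(\mathbf{x},\mathbf{y}) = \#(X \cap [\mathbf{x},\mathbf{y})) - N\,|[\mathbf{x},\mathbf{y})|$ (not normalized by $N$). The extreme and periodic $L_2$-discrepancies (nonnegative square roots) are given by $$L_2^{\mathrm{extr}}(X)^2 = \int_{[0,1)^d} \int_{\mathbf{y} > \mathbf{x}} D_X(\mathbf{x},\mathbf{y})^2 \, d\mathbf{y}\, d\mathbf{x}, \qquad L_2^{\mathrm{per}}(X)^2 = \int_{[0,1)^d} \int_{[0,1)^d} D_X(\mathbf{x},\mathbf{y})^2 \, d\mathbf{y}\, d\mathbf{x},$$ where in the first integral $\mathbf{y} \in [0,1)^d$ and $\mathbf{y}>\mathbf{x}$ is meant componentwise. *)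

(* Defs.v *)
From HB Require Import structures.
From mathcomp Require Import all_boot all_order all_algebra.
From mathcomp Require Import finmap.
From mathcomp Require Import all_classical all_reals all_analysis.

Set Implicit Arguments.
Unset Strict Implicit.
Unset Printing Implicit Defensive.

Import Order.TTheory GRing.Theory Num.Theory.
Import numFieldNormedType.Exports.

Local Open Scope classical_set_scope.
Local Open Scope ring_scope.

Section cons_measure.
Context {d : measure_display} {T : measurableType d} {R : realType} {n : nat}.

Definition tcons (p : T * n.-tuple T) : n.+1.-tuple T := cons_tuple p.1 p.2.

Lemma measurable_tcons : measurable_fun [set: T * n.-tuple T] tcons.
Proof. exact: (measurable_cons measurable_fst measurable_snd). Qed.

Variables (m1 : {sigma_finite_measure set T -> \bar R})
          (m2 : {sigma_finite_measure set (n.-tuple T) -> \bar R}).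

Definition cons_measure : set (n.+1.-tuple T) -> \bar R :=
  pushforward (m1 \x m2)%E tcons.

Let cons_measure0 : cons_measure set0 = 0%E.
Proof. by rewrite /cons_measure /pushforward preimage_set0 measure0. Qed.

Let cons_measure_ge0 A : (0 <= cons_measure A)%E.
Proof. exact: (@measure_ge0 _ _ _ (m1 \x m2)%E). Qed.

Let cons_measure_sigma_additive : semi_sigma_additive cons_measure.
Proof.
move=> F mF tF mUF; rewrite /cons_measure /pushforward preimage_bigcup.
have mp A : measurable A -> measurable (tcons @^-1` A).
  by move=> mA; rewrite -[X in measurable X]setTI; exact: measurable_tcons.
apply: measure_semi_sigma_additive.
- by move=> k; exact: mp.
- apply/trivIsetP => /= i j _ _ ij; rewrite -preimage_setI.
  by move/trivIsetP : tF => /(_ _ _ _ _ ij) ->//; rewrite preimage_set0.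
- by rewrite -preimage_bigcup; exact: mp.
Qed.

HB.instance Definition _ := isMeasure.Build _ _ _ cons_measure
  cons_measure0 cons_measure_ge0 cons_measure_sigma_additive.

Lemma measurable_tnth_behead (A : set T) (B : set (n.-tuple T)) :
  measurable A -> measurable B ->
  measurable [set t : n.+1.-tuple T | A (thead t) /\ B [tuple of behead t]].
Proof.
move=> mA mB.
have -> : [set t : n.+1.-tuple T | A (thead t) /\ B [tuple of behead t]] =
  ((@tnth _ T ^~ ord0) @^-1` A) `&`
  ((fun t : n.+1.-tuple T => [tuple of behead t]) @^-1` B) by [].
apply: measurableI.
- by rewrite -[X in measurable X]setTI; exact: measurable_tnth.
- by rewrite -[X in measurable X]setTI; exact: measurable_behead.
Qed.

Lemma cons_measureE (A : set T) (B : set (n.-tuple T)) :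
  measurable A -> measurable B ->
  cons_measure [set t | A (thead t) /\ B [tuple of behead t]] =
  (m1 A * m2 B)%E.
Proof.
move=> mA mB; rewrite -product_measure1E// /cons_measure /pushforward.
have bE (a : T) (b : n.-tuple T) : [tuple of behead (tcons (a, b))] = b.
  exact: val_inj.
by congr product_measure1; apply/seteqP; split=> -[a b] /=; rewrite theadE bE.
Qed.

Let cons_measure_sigma_finite : sigma_finite setT cons_measure.
Proof.
have /sigma_finiteP[F [TF ndF Foo]] := sigma_finiteT m1.
have /sigma_finiteP[G [TG ndG Goo]] := sigma_finiteT m2.
exists (fun k => [set t | F k (thead t) /\ G k [tuple of behead t]]).
  apply/seteqP; split=> // t _.
  have [i _ Fi] : (\bigcup_i F i) (thead t) by rewrite -TF.
  have [j _ Gj] : (\bigcup_i G i) [tuple of behead t] by rewrite -TG.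
  exists (maxn i j) => //; split.
  - by move: Fi; exact/subsetPset/ndF/leq_maxl.
  - by move: Gj; exact/subsetPset/ndG/leq_maxr.
move=> k; have [mF Foo'] := Foo k; have [mG Goo'] := Goo k.
split; first exact: measurable_tnth_behead.
by rewrite cons_measureE// lte_mul_pinfty// ge0_fin_numE.
Qed.

HB.instance Definition _ := Measure_isSigmaFinite.Build _ _ _ cons_measure
  cons_measure_sigma_finite.

End cons_measure.

(* Lebesgue measure on R^n as an n-fold product; its value on boxes is
   [lebesgue_tuple_box]. *)
Fixpoint lebesgue_tuple (R : realType) (n : nat) :
    {sigma_finite_measure set (n.-tuple (measurableTypeR R)) -> \bar R} :=
  match n with
  | 0 => \d_([tuple] : 0.-tuple (measurableTypeR R))
  | k.+1 => cons_measure (@lebesgue_measure R) (lebesgue_tuple R k)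
  end.

Lemma lebesgue_tuple_box (R : realType) (n : nat) (A : 'I_n -> set R) :
  (forall k, measurable (A k)) ->
  lebesgue_tuple R n [set z | forall k, A k (tnth z k)] =
  (\prod_(k < n) lebesgue_measure (A k))%E.
Proof.
elim: n A => [|n IHn] A mA.
  rewrite big_ord0 /= (_ : [set _ | _] = setT) ?diracT//.
  by apply/seteqP; split=> // z _ [].
rewrite big_ord_recl -IHn//=.
rewrite -(@cons_measureE _ (measurableTypeR R) R n)//.
  congr cons_measure; apply/seteqP; split=> z /=.
    move=> Az; split; first exact: Az.
    by move=> k; have := Az (lift ord0 k); rewrite {1}(tuple_eta z) tnthS.
  move=> [A0 AS] k; case: (unliftP ord0 k) => [j|] ->//.
  by rewrite (tuple_eta z) tnthS.
  exact: mA.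
rewrite [X in measurable X](_ : _ = \bigcap_(k in [set: 'I_n])
  (@tnth _ (measurableTypeR R) ^~ k) @^-1` A (lift ord0 k)).
  apply: fin_bigcap_measurable => // k _.
  rewrite -[X in measurable X]setTI; apply: measurable_tnth => //; exact: mA.
by apply/seteqP; split=> z /= Az k; [move=> _; exact: Az | exact: Az].
Qed.

Section discrepancy.
Context {R : realType}.

Definition weak_latin_hypercube (d M : nat) (H : {set d.-tuple 'I_M}) : Prop :=
  (* the entry [tnth m k] is overwritten, so m ranges over the other entries *)
  forall (k : 'I_d) (m : d.-tuple 'I_M),
    exists! j : 'I_M, [tuple if i == k then j else tnth m i | i < d] \in H.

Definition latin_points (d M : nat) (H : {set d.-tuple 'I_M}) :
    {fset d.-tuple R} :=
  [fset [tuple (tnth h i)%:R / M%:R : R | i < d] | h : d.-tuple 'I_M in H]%fset.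

Definition cube (d : nat) : set (d.-tuple R) :=
  [set z | forall k, 0 <= tnth z k < 1].
Arguments cube : clear implicits.

(* For x = y this is the whole of [0, 1). *)
Definition periodic_itv (x y : R) : set R :=
  if x < y then [set z | 0 <= z < 1 /\ x <= z < y]
  else [set z | 0 <= z < 1 /\ (x <= z \/ z < y)].

Lemma periodic_itvE (x y : R) : 0 <= x < 1 -> 0 <= y < 1 ->
  periodic_itv x y = if x < y then `[x, y[%classic else `[x, 1[ `|` `[0, y[.
Proof.
move=> /andP[x0 x1] /andP[y0 y1]; rewrite /periodic_itv.
case: ltP => xy; apply/seteqP; split=> z /=; rewrite !in_itv/=.
- by case.
- by move=> /andP[xz zy]; rewrite xz zy (le_trans x0)// (lt_trans zy).
- by move=> [/andP[z0 z1]] [xz|zy]; [left|right]; apply/andP.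
- case=> /andP[a b].
    by split; [rewrite b (le_trans x0)|left].
  by split; [rewrite a (lt_trans b)|right].
Qed.

Lemma measurable_periodic_itv (x y : R) : measurable (periodic_itv x y).
Proof.
rewrite /periodic_itv; case: ifP => _.
  rewrite (_ : [set _ | _] = `[0, 1[ `&` `[x, y[); first exact: measurableI.
  by apply/seteqP; split=> z /=; rewrite !in_itv.
rewrite (_ : [set _ | _] = `[0, 1[ `&` (`[x, +oo[ `|` `]-oo, y[)).
  by apply: measurableI => //; exact: measurableU.
by apply/seteqP; split=> z /=; rewrite !in_itv/= andbT.
Qed.

Lemma periodic_itv_measure (x y : R) : 0 <= x < 1 -> 0 <= y < 1 ->
  lebesgue_measure (periodic_itv x y) =
  (if x < y then y - x else 1 - x + y)%:E.
Proof.
move=> hx hy; rewrite periodic_itvE//.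
case/andP: hx => x0 x1; case/andP: hy => y0 y1.
case: ltP => xy; first by rewrite lebesgue_measure_itv/= lte_fin xy.
rewrite measureU//=; last first.
  apply/seteqP; split=> // z /=; rewrite !in_itv/= => -[/andP[xz _] /andP[_ zy]].
  by have := lt_le_trans zy (le_trans xy xz); rewrite ltxx.
rewrite !lebesgue_measure_itv/= !lte_fin x1.
case: (ltP 0 y) => y0'; first by rewrite -!EFinB -EFinD subr0.
by rewrite (_ : y = 0) ?addr0 ?adde0//; apply/eqP; rewrite eq_le y0 y0'.
Qed.

Definition periodic_box (d : nat) (x y : d.-tuple R) : set (d.-tuple R) :=
  [set z | forall k, periodic_itv (tnth x k) (tnth y k) (tnth z k)].

(* The measure is finite; [volumeE] gives the explicit product. *)
Definition volume (d : nat) (x y : d.-tuple R) : R :=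
  fine (lebesgue_tuple R d (periodic_box x y)).

Lemma volumeE (d : nat) (x y : d.-tuple R) : cube d x -> cube d y ->
  volume x y = \prod_(k < d)
    (if tnth x k < tnth y k then tnth y k - tnth x k
     else 1 - tnth x k + tnth y k).
Proof.
move=> cx cy; rewrite /volume /periodic_box.
rewrite (lebesgue_tuple_box (A := fun k => periodic_itv (tnth x k) (tnth y k))).
  rewrite (eq_bigr (fun k => (if tnth x k < tnth y k then tnth y k - tnth x k
     else 1 - tnth x k + tnth y k)%:E)) ?prodEFin//= => k _.
  by rewrite periodic_itv_measure.
by move=> k; exact: measurable_periodic_itv.
Qed.

Definition discrepancy (d : nat) (X : {fset d.-tuple R}) (x y : d.-tuple R) : R :=
  #|` [fset z in X | z \in periodic_box x y]%fset |%:R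
  - #|` X |%:R * volume x y.

(* The integrands are bounded on the unit cube, so [fine] loses nothing. *)
Definition L2extr (d : nat) (X : {fset d.-tuple R}) : R :=
  Num.sqrt (fine (\int[lebesgue_tuple R d]_(x in cube d)
    \int[lebesgue_tuple R d]_(y in [set y | cube d y /\
                                  forall k, (tnth x k < tnth y k :> R)%R])
      ((discrepancy X x y ^+ 2)%R)%:E)).

Definition L2per (d : nat) (X : {fset d.-tuple R}) : R :=
  Num.sqrt (fine (\int[lebesgue_tuple R d]_(x in cube d)
    \int[lebesgue_tuple R d]_(y in cube d)
      ((discrepancy X x y ^+ 2)%R)%:E)).

End discrepancy.

(* Main.v *)
Require Import Defs.
From mathcomp Require Import all_boot all_order all_algebra.
From mathcomp Require Import finmap.
From mathcomp Require Import all_classical all_reals all_analysis.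
From mathcomp Require Import measurable_realfun.
From mathcomp Require Import ring lra.

Set Implicit Arguments.
Unset Strict Implicit.
Unset Printing Implicit Defensive.

Import Order.TTheory GRing.Theory Num.Theory.
Import numFieldNormedType.Exports.

Local Open Scope classical_set_scope.
Local Open Scope ring_scope.

(** The discrepancy function is bounded below by its part in finitely many
explicit directions.  Write [D] for the discrepancy function of [X] and, for
[x, y] in $[0,1)$, let [A_z (x, y)] be the indicator of $z \in [x,y)$ and
[L (x, y)] the length of $[x,y)$, so that on pairs of points
$D = \sum_{h \in H} \prod_k A_{h_k/M} - N \prod_k L$.  The one-dimensional
grid of the multiples of $1/M$ has discrepancy function
$W = \sum_{i<M} A_{i/M} - M L$, and every one-dimensional projection of [X]
is $N/M$ copies of that grid.  This suggests the test function
$\phi = (N/M) \sum_k W(x_k,y_k) \prod_{j \ne k} L(x_j,y_j)$, and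
$D^2 \ge 2 D \phi - \phi^2$ reduces everything to integrals of tensor
products, i.e. to the one-dimensional Gram matrix of the [A_{i/M}] and [L].

Two facts about that matrix make $\int D \phi$ computable:
$\langle A_{i/M}, W \rangle$ is a constant $a$ independent of $i$, and either
$a = 0$ or $\langle A_{i/M}, L \rangle = \langle L, L \rangle$ for all $i$.
With $g = \langle L, W \rangle$ and $\kappa = \langle L, L \rangle$ one
gets $\langle W, W \rangle = M (a - g)$ and
$$\int D^2 \ge (N/M)^2 (d M (a-g) \kappa^{d-1} - d (d-1) g^2 \kappa^{d-2})$$
([local_discrepancy_sq_ge]).  The Latin property gives
$N = M^{d-1}$, whence $N/M = M^{d-2} = N^{(d-2)/(d-1)}$.

In the extreme case all functions are cut to $x < y$ and $a = 0$,
$g = -1/(12M)$, $\kappa = 1/12$; the cross terms cost the factor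
$1 - (d-1)/M^2$.  In the periodic case $a = 1/(6M)$, $g = 0$, $\kappa = 1/3$,
and nothing is lost.  The periodic Gram matrix follows from the extreme one:
with $S$ the indicator of $y \le x$, the periodic version of $f$ is
$f(x,y) + S(x,y) - f(y,x)$, because for $y \le x$ the periodic interval is the
complement of $[y,x)$ ([has_integral_periodized]). *)

(** * Functions with a given finite integral *)

Section has_integral.
Context {d : measure_display} {T : measurableType d} {R : realType}.
Variable m : {measure set T -> \bar R}.
Implicit Types (f g : T -> R) (u v : R).

(** Keeping integrability together with the value makes finite linear
combinations of integrals compositional, without side conditions. *)
Definition has_integral (f : T -> R) (v : R) : Prop :=
  m.-integrable setT (EFin \o f) /\ (\int[m]_x (f x)%:E = v%:E)%E.

Lemma has_integral_nneg f v : measurable_fun setT f -> (forall x, 0 <= f x) ->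
  (\int[m]_x (f x)%:E = v%:E)%E -> has_integral f v.
Proof.
move=> mf f0 fv; split=> //; apply/integrableP; split.
  exact/measurable_EFinP.
under eq_integral => x _ do rewrite /= ger0_norm//.
by rewrite fv ltry.
Qed.

Lemma has_integralD f g u v : has_integral f u -> has_integral g v ->
  has_integral (fun x => f x + g x) (u + v).
Proof.
move=> [fi fu] [gi gv]; split; first exact: (integrableD _ fi gi).
by under eq_integral do rewrite EFinD; rewrite integralD// fu gv.
Qed.

Lemma has_integralZ c f v : has_integral f v ->
  has_integral (fun x => c * f x) (c * v).
Proof.
move=> [fi fv]; split; first exact: (integrableZl _ c fi).
by under eq_integral do rewrite EFinM; rewrite integralZl// fv.
Qed.

Lemma has_integralB f g u v : has_integral f u -> has_integral g v ->
  has_integral (fun x => f x - g x) (u - v).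
Proof.
move=> fu gv; rewrite -(mulN1r v).
under eq_fun do rewrite -(mulN1r (g _)).
exact/has_integralD/has_integralZ.
Qed.

Lemma has_integral0 : has_integral (fun=> 0) 0.
Proof. by split; [exact: integrable0|rewrite integral0]. Qed.

Lemma has_integral_sum (I : Type) (s : seq I) (P : pred I) (f : I -> T -> R)
    (v : I -> R) :
  (forall i, P i -> has_integral (f i) (v i)) ->
  has_integral (fun x => \sum_(i <- s | P i) f i x) (\sum_(i <- s | P i) v i).
Proof.
move=> fv; elim: s => [|i s IHs].
  by under eq_fun do rewrite big_nil; rewrite big_nil; exact: has_integral0.
under eq_fun do rewrite big_cons; rewrite big_cons.
by case: ifPn => // Pi; apply: has_integralD => //; exact: fv.
Qed.

Lemma has_integral_ge0 f v : has_integral f v -> (forall x, 0 <= f x) -> 0 <= v.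
Proof.
move=> [_ fv] f0; rewrite -lee_fin -fv.
by apply: integral_ge0 => x _; rewrite lee_fin.
Qed.

Lemma has_integral_fun f v : has_integral f v -> measurable_fun setT f.
Proof. by move=> [/measurable_int/measurable_EFinP]. Qed.

Lemma has_integral_uniq f u v :
  has_integral f u -> has_integral f v -> u = v.
Proof. by move=> [_ fu] [_]; rewrite fu => -[]. Qed.

(** The positive and negative parts, indexed by their sign so that a product of
[n] such decompositions expands over the boolean functions. *)
Lemma has_integral_posneg f v :
  has_integral f v -> exists (g : bool -> T -> R) (w : bool -> R),
  [/\ forall b x, 0 <= g b x, forall b, has_integral (g b) (w b),
      forall x, f x = \sum_(b : bool) (-1) ^+ b * g b x &
      v = \sum_(b : bool) (-1) ^+ b * w b].
Proof.
move=> fv; have [fi _] := fv.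
pose g b := if b then f^\- else f^\+.
have g0 b x : 0 <= g b x.
  by case: b; rewrite /g ?funrneg_ge0 ?funrpos_ge0.
have gi b : m.-integrable setT (EFin \o g b).
  by case: b; [exact: integrable_funrneg|exact: integrable_funrpos].
pose w b := fine (\int[m]_x (g b x)%:E).
have gw b : has_integral (g b) (w b).
  by split => //; rewrite /w fineK//;
    exact: (integrable_fin_num measurableT (gi b)).
have fg x : f x = \sum_(b : bool) (-1) ^+ b * g b x.
  rewrite big_bool/= expr1 expr0 mul1r mulN1r addrC.
  by rewrite -[in LHS](funrposBneg f).
exists g, w; split => //.
apply: has_integral_uniq fv _; rewrite (funext fg).
by apply: has_integral_sum => b _; exact: (has_integralZ _ (gw b)).
Qed.

End has_integral.

Section product.
Context {d1 d2 : measure_display} {T1 : measurableType d1}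
  {T2 : measurableType d2} {R : realType}.
Variables (m1 : {sigma_finite_measure set T1 -> \bar R})
          (m2 : {sigma_finite_measure set T2 -> \bar R}).

Lemma has_integral_tonelli (f : T1 * T2 -> R) g v :
  measurable_fun setT f -> (forall p, 0 <= f p) ->
  (forall x, \int[m2]_y (f (x, y))%:E = (g x)%:E)%E ->
  (\int[m1]_x (g x)%:E = v%:E)%E -> has_integral (m1 \x m2)%E f v.
Proof.
move=> mf f0 fg gv; apply: has_integral_nneg => //.
rewrite (fubini_tonelli1 (EFin \o f))//; last exact/measurable_EFinP.
by rewrite -gv; apply: eq_integral => x _; exact: fg.
Qed.

Lemma has_integral_iterated (f : T1 * T2 -> R) v :
  has_integral (m1 \x m2)%E f v -> (forall p, 0 <= f p) ->
  (\int[m1]_x \int[m2]_y (f (x, y))%:E = v%:E)%E.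
Proof.
move=> fv f0; rewrite -fv.2 (fubini_tonelli1 (EFin \o f))//.
apply/measurable_EFinP; exact: (has_integral_fun fv).
Qed.

End product.

Lemma has_integral_swap (d : measure_display) (T : measurableType d)
    (R : realType) (m : {sigma_finite_measure set T -> \bar R})
    (f : T * T -> R) v :
  (forall p, 0 <= f p) -> has_integral (m \x m)%E f v ->
  has_integral (m \x m)%E (fun p => f (p.2, p.1)) v.
Proof.
move=> f0 fv; have mf := has_integral_fun fv.
have mswap : measurable_fun setT (fun p => f (p.2, p.1)).
  by apply: (measurableT_comp mf); exact: measurable_fun_pair.
apply: has_integral_nneg => //.
rewrite (fubini_tonelli1 (EFin \o (fun p => f (p.2, p.1)))); first last.
- by move=> p; rewrite lee_fin.
- exact/measurable_EFinP.
rewrite -fv.2 (fubini_tonelli2 (EFin \o f))//.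
exact/measurable_EFinP.
Qed.

(** * Integrals of tensor products over pairs of points of the cube *)

Section tensor.
Context {R : realType}.
Local Notation mu := (@lebesgue_measure R).
Local Notation T := (measurableTypeR R).

Lemma emeasurable_prod (d : measure_display) (U : measurableType d)
    (I : Type) (s : seq I) (f : I -> U -> \bar R) :
  (forall i, measurable_fun setT (f i)) ->
  measurable_fun setT (fun x => \prod_(i <- s) f i x)%E.
Proof.
move=> mf; elim: s => [|i s IHs].
  by under eq_fun do rewrite big_nil; exact: measurable_cst.
by under eq_fun do rewrite big_cons; exact: emeasurable_funM.
Qed.

(** Values in the extended reals are needed: the factors are later partial
integrals, which may be infinite on a negligible set. *)
Lemma integral_lebesgue_tuple_prod (n : nat) (g : 'I_n -> T -> \bar R) :
  (forall k, measurable_fun setT (g k)) -> (forall k x, 0 <= g k x)%E ->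
  (\int[lebesgue_tuple R n]_t \prod_(k < n) g k (tnth t k) =
   \prod_(k < n) \int[mu]_x g k x)%E.
Proof.
elim: n g => [|n IHn] g mg g0.
  rewrite big_ord0/=; under eq_integral do rewrite big_ord0.
  by rewrite integral_dirac// diracT mul1e.
rewrite big_ord_recl -IHn//=.
rewrite /cons_measure ge0_integral_pushforward//=; first last.
- by move=> t _; apply: prode_ge0.
- apply: emeasurable_prod => k.
  by apply: (measurableT_comp (mg k)); exact: measurable_tnth.
- exact: measurable_tcons.
have mP : measurable_fun setT (fun t : n.-tuple T =>
    \prod_(k < n) g (lift ord0 k) (tnth t k))%E.
  apply: emeasurable_prod => k.
  by apply: (measurableT_comp (mg _)); exact: measurable_tnth.
rewrite preimage_setT (fubini_tonelli1 (fun p : T * n.-tuple T =>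
    \prod_(k < n.+1) g k (tnth (tcons p) k))%E)//=; first last.
- by move=> p; apply: prode_ge0.
- apply: emeasurable_prod => k.
  apply: (measurableT_comp (mg k)).
  by apply: (measurableT_comp (measurable_tnth k)); exact: measurable_tcons.
rewrite -ge0_integralZr//; last by apply: integral_ge0 => t _; exact: prode_ge0.
apply: eq_integral => x _; rewrite /fubini_F -ge0_integralZl//; last first.
  by move=> t _; exact: prode_ge0.
apply: eq_integral => t _; rewrite big_ord_recl; congr (_ * _)%E.
by apply: eq_bigr => k _; rewrite tnthS.
Qed.

(** Tonelli splits the double integral, and [integral_lebesgue_tuple_prod]
applies once in [y] and once in [x]. *)
Lemma has_integral_tensor_nneg (n : nat) (f : 'I_n -> T * T -> R) v :
  (forall k p, 0 <= f k p) ->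
  (forall k, has_integral (mu \x mu)%E (f k) (v k)) ->
  has_integral (lebesgue_tuple R n \x lebesgue_tuple R n)%E
    (fun p => \prod_(k < n) f k (tnth p.1 k, tnth p.2 k)) (\prod_(k < n) v k).
Proof.
move=> f0 fv; have mf k := has_integral_fun (fv k).
have mf' k : measurable_fun setT (fun p : n.-tuple T * n.-tuple T =>
    f k (tnth p.1 k, tnth p.2 k)).
  apply: (measurableT_comp (mf k)); apply: measurable_fun_pair.
    by apply: (measurableT_comp (measurable_tnth k)); exact: measurable_fst.
  by apply: (measurableT_comp (measurable_tnth k)); exact: measurable_snd.
have mfE k : measurable_fun setT (EFin \o f k) by exact/measurable_EFinP.
have f0E k p : (0 <= (EFin \o f k) p)%E by rewrite lee_fin.
have prodE (w : 'I_n -> R) :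
    (\prod_(k < n) w k)%:E = (\prod_(k < n) (w k)%:E)%E.
  by rewrite prodEFin.
apply: has_integral_nneg.
- exact: measurable_prod.
- by move=> p; exact: prodr_ge0.
under eq_integral do rewrite prodE.
rewrite (fubini_tonelli1 (fun p : n.-tuple T * n.-tuple T =>
    \prod_(k < n) (f k (tnth p.1 k, tnth p.2 k))%:E)%E)//; first last.
- by move=> p; apply: prode_ge0 => k _; rewrite lee_fin.
- by apply: emeasurable_prod => k; exact/measurable_EFinP.
rewrite prodE; transitivity (\int[lebesgue_tuple R n]_x
    \prod_(k < n) fubini_F mu (EFin \o f k) (tnth x k))%E; last first.
  rewrite (integral_lebesgue_tuple_prod
    (g := fun k => fubini_F mu (EFin \o f k))).
  - by apply: eq_bigr => k _; rewrite -(fv k).2 (fubini_tonelli1 (EFin \o f k)).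
  - by move=> k; exact: measurable_fun_fubini_tonelli_F.
  - by move=> k x; apply: integral_ge0 => y _; rewrite lee_fin.
apply: eq_integral => x _; rewrite /fubini_F.
rewrite (integral_lebesgue_tuple_prod
  (g := fun k y => (f k (tnth x k, y))%:E))//.
- move=> k; apply/measurable_EFinP.
  by apply: (measurableT_comp (mf k)); exact: measurable_fun_pair.
- by move=> k y; rewrite lee_fin.
Qed.

(** Expanding every factor into its positive and negative parts reduces to
nonnegative factors. *)
Lemma has_integral_tensor (n : nat) (f : 'I_n -> T * T -> R) v :
  (forall k, has_integral (mu \x mu)%E (f k) (v k)) ->
  has_integral (lebesgue_tuple R n \x lebesgue_tuple R n)%E
    (fun p => \prod_(k < n) f k (tnth p.1 k, tnth p.2 k)) (\prod_(k < n) v k).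
Proof.
move=> fv.
have /choice[g /choice[w gw]] k := has_integral_posneg (fv k).
have -> : (fun p : n.-tuple T * n.-tuple T =>
      \prod_(k < n) f k (tnth p.1 k, tnth p.2 k)) =
    (fun p => \sum_(s : {ffun 'I_n -> bool}) (\prod_(k < n) (-1) ^+ s k) *
       \prod_(k < n) g k (s k) (tnth p.1 k, tnth p.2 k)).
  apply/funext => p.
  under eq_bigr => k _ do rewrite (let: And4 _ _ fg _ := gw k in fg _).
  rewrite bigA_distr_bigA/=; apply: eq_bigr => s _.
  by rewrite big_split.
have -> : \prod_(k < n) v k = \sum_(s : {ffun 'I_n -> bool})
    (\prod_(k < n) (-1) ^+ s k) * \prod_(k < n) w k (s k).
  under eq_bigr => k _ do rewrite (let: And4 _ _ _ vw := gw k in vw).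
  rewrite bigA_distr_bigA/=; apply: eq_bigr => s _.
  by rewrite big_split.
apply: has_integral_sum => s _; apply: has_integralZ.
apply: (has_integral_tensor_nneg (f := fun k => g k (s k))) => k.
  by case: (gw k).
by case: (gw k).
Qed.

End tensor.

(** * The lower bound from the one-dimensional projections *)

Section projection_bound.
Context {R : realType}.
Local Notation T := (measurableTypeR R).
Local Notation mu2 := (@lebesgue_measure R \x @lebesgue_measure R)%E.
Variables (M d : nat) (H : {set d.-tuple 'I_M}).
Local Notation mud := (lebesgue_tuple R d \x lebesgue_tuple R d)%E.

Lemma prodr_one_exception (k : 'I_d) (x y : R) :
  \prod_j (if j == k then x else y) = x * y ^+ d.-1.
Proof.
rewrite (bigD1 k)//= eqxx; congr (_ * _).
under eq_bigr => j jk do rewrite (negbTE jk).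
by rewrite prodr_const cardC1 card_ord.
Qed.

Lemma prodr_two_exceptions (k l : 'I_d) (x y : R) : k != l ->
  \prod_j (if j == k then x else if j == l then x else y) = x ^+ 2 * y ^+ d.-2.
Proof.
move=> kl; rewrite (bigD1 k)//= eqxx (bigD1 l)/=; last by rewrite eq_sym.
rewrite eq_sym (negbTE kl) eqxx expr2 mulrA; congr (_ * _).
under eq_bigr => j /andP[jk jl] do rewrite (negbTE jk) (negbTE jl).
rewrite prodr_const (eq_card (B := ~: [set k; l]%SET)); last first.
  by move=> j; rewrite !inE negb_or.
by rewrite cardsCs finset.setCK cards2 kl card_ord subn2.
Qed.

Variables (A : 'I_M -> T * T -> R) (L : T * T -> R).
Variables (G : 'I_M -> 'I_M -> R) (b : 'I_M -> R) (kap : R).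
Hypothesis AA : forall i j, has_integral mu2 (fun p => A i p * A j p) (G i j).
Hypothesis AL : forall i, has_integral mu2 (fun p => A i p * L p) (b i).
Hypothesis LL : has_integral mu2 (fun p => L p * L p) kap.

Definition tensor (f : 'I_d -> T * T -> R) (p : d.-tuple T * d.-tuple T) : R :=
  \prod_(k < d) f k (tnth p.1 k, tnth p.2 k).

Definition local_discrepancy (p : d.-tuple T * d.-tuple T) : R :=
  \sum_(h in H) tensor (fun k => A (tnth h k)) p
  - #|H|%:R * tensor (fun=> L) p.

Definition grid_discrepancy (p : T * T) : R :=
  \sum_(i < M) A i p - M%:R * L p.

Local Notation W := grid_discrepancy.

Lemma tensorM f g p :
  tensor f p * tensor g p = tensor (fun k q => f k q * g k q) p.
Proof. by rewrite /tensor -big_split. Qed.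

Lemma has_integral_local_discrepancy_tensor (f : 'I_d -> T * T -> R)
    (u : 'I_M -> 'I_d -> R) (w : 'I_d -> R) :
  (forall i k, has_integral mu2 (fun p => A i p * f k p) (u i k)) ->
  (forall k, has_integral mu2 (fun p => L p * f k p) (w k)) ->
  has_integral mud (fun p => local_discrepancy p * tensor f p)
    (\sum_(h in H) \prod_(k < d) u (tnth h k) k - #|H|%:R * \prod_(k < d) w k).
Proof.
move=> fu fw.
rewrite (_ : (fun p => _) = (fun p =>
    \sum_(h in H) tensor (fun k q => A (tnth h k) q * f k q) p
    - #|H|%:R * tensor (fun k q => L q * f k q) p)); last first.
  apply/funext => p; rewrite mulrBl mulr_suml -mulrA tensorM; congr (_ - _).
  by apply: eq_bigr => h _; rewrite tensorM.
apply: has_integralB; last by apply: has_integralZ; exact: has_integral_tensor.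
apply: has_integral_sum => h _.
by apply: (has_integral_tensor (f := fun k q => A (tnth h k) q * f k q)).
Qed.

Lemma has_integral_local_discrepancy_sq :
  exists v, has_integral mud (fun p => local_discrepancy p ^+ 2) v.
Proof.
have LA i : has_integral mu2 (fun p => L p * A i p) (b i).
  by under eq_fun do rewrite mulrC; exact: AL.
eexists; rewrite (_ : (fun p => _) = (fun p =>
    \sum_(h in H) local_discrepancy p * tensor (fun k => A (tnth h k)) p
    - #|H|%:R * (local_discrepancy p * tensor (fun=> L) p))); last first.
  apply/funext => p; rewrite expr2 {2}/local_discrepancy mulrBr mulr_sumr.
  by rewrite mulrCA.
apply: has_integralB.
  apply: has_integral_sum => h _.
  apply: (has_integral_local_discrepancy_tensor
    (u := fun i k => G i (tnth h k)) (w := fun k => b (tnth h k))) => //.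
apply: has_integralZ.
exact: (has_integral_local_discrepancy_tensor
    (u := fun i k => b i) (w := fun k => kap)).
Qed.

Variable a : R.
Let g := \sum_(i < M) b i - M%:R * kap.
Hypothesis rowG : forall i, \sum_(j < M) G i j - M%:R * b i = a.
Hypothesis ab : a = 0 \/ forall i, b i = kap.

Lemma has_integral_AW i : has_integral mu2 (fun p => A i p * W p) a.
Proof.
rewrite -(rowG i) (_ : (fun p => _) = (fun p =>
    \sum_(j < M) A i p * A j p - M%:R * (A i p * L p))); last first.
  by apply/funext => p; rewrite mulrBr mulr_sumr mulrCA.
apply: has_integralB; last exact/has_integralZ.
by apply: has_integral_sum => j _.
Qed.

Lemma has_integral_LW : has_integral mu2 (fun p => L p * W p) g.
Proof.
rewrite (_ : (fun p => _) = (fun p =>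
    \sum_(j < M) A j p * L p - M%:R * (L p * L p))); last first.
  by apply/funext => p; rewrite mulrC mulrBl mulr_suml mulrA.
apply: has_integralB; last exact/has_integralZ.
by apply: has_integral_sum => j _.
Qed.

(** Expand the first [W] and use that [A i] has the same product with [W] for
every [i]. *)
Lemma has_integral_WW : has_integral mu2 (fun p => W p * W p) (M%:R * (a - g)).
Proof.
rewrite (_ : (fun p => _) = (fun p =>
    \sum_(j < M) A j p * W p - M%:R * (L p * W p))); last first.
  by apply/funext => p; rewrite {1}/W mulrBl mulr_suml mulrA.
rewrite mulrBr; apply: has_integralB; last exact/has_integralZ/has_integral_LW.
rewrite mulr_natl -[X in _ *+ X](card_ord M) -sumr_const.
by apply: has_integral_sum => j _; exact: has_integral_AW.
Qed.

(** The factors of the [k]-th summand of the test function. *)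
Definition direction (k j : 'I_d) : T * T -> R := if j == k then W else L.

Lemma has_integral_direction2 k l :
  has_integral mud (fun p => tensor (direction k) p * tensor (direction l) p)
    (if k == l then M%:R * (a - g) * kap ^+ d.-1 else g ^+ 2 * kap ^+ d.-2).
Proof.
under eq_fun do rewrite tensorM.
have WL : has_integral mu2 (fun p => W p * L p) g.
  by under eq_fun do rewrite mulrC; exact: has_integral_LW.
case: eqVneq => [->|kl].
  rewrite -(prodr_one_exception l).
  apply: (has_integral_tensor (f := fun j q => direction l j q * direction l j q)).
  move=> j; rewrite /direction; case: eqP => _ //; exact: has_integral_WW.
rewrite -(prodr_two_exceptions _ _ kl).
apply: (has_integral_tensor (f := fun j q => direction k j q * direction l j q)).
move=> j; rewrite /direction; case: eqVneq => [->|_]; last first.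
  by case: eqP => // _; exact: has_integral_LW.
by rewrite (negbTE kl).
Qed.

(** For a point [h] the product is [a] times the product of the [b (tnth h j)]
over [j <> k]; the alternative [ab] is what makes it independent of [h]. *)
Lemma has_integral_local_discrepancy_direction k :
  has_integral mud (fun p => local_discrepancy p * tensor (direction k) p)
    (#|H|%:R * ((a - g) * kap ^+ d.-1)).
Proof.
have -> : #|H|%:R * ((a - g) * kap ^+ d.-1) =
   \sum_(h in H) \prod_(j < d) (if j == k then a else b (tnth h j))
   - #|H|%:R * \prod_(j < d) (if j == k then g else kap).
  rewrite prodr_one_exception mulrBl mulrBr; congr (_ - _).
  rewrite mulr_natl -sumr_const; apply: eq_bigr => h _.
  case: ab => [->|bk].
    by rewrite (bigD1 k)//= eqxx !mul0r.
  by under eq_bigr do rewrite bk; rewrite prodr_one_exception.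
apply: (has_integral_local_discrepancy_tensor
    (u := fun i j => if j == k then a else b i)
    (w := fun j => if j == k then g else kap)).
- move=> i j; rewrite /direction; case: eqP => _ //; exact: has_integral_AW.
- move=> j; rewrite /direction; case: eqP => _ //; exact: has_integral_LW.
Qed.

(** Integrate the square of [local_discrepancy] minus [lam] times the sum of the
[d] directions.  The choice of [lam] makes the integral against a direction
equal to [lam] times the squared norm of that direction. *)
Lemma local_discrepancy_sq_ge v : (0 < M)%N ->
  has_integral mud (fun p => local_discrepancy p ^+ 2) v ->
  (#|H|%:R / M%:R) ^+ 2 * (d%:R * (M%:R * (a - g)) * kap ^+ d.-1
     - d%:R * (d%:R - 1) * g ^+ 2 * kap ^+ d.-2) <= v.
Proof.
move=> M0 vP; set lam := _ / _; set nu := _ * (a - g).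
have Mn0 : M%:R != 0 :> R by rewrite pnatr_eq0 -lt0n.
have lamE : #|H|%:R * (a - g) = lam * nu by rewrite /lam /nu; field.
have I1 : has_integral mud
    (fun p => \sum_k local_discrepancy p * tensor (direction k) p)
    (d%:R * (lam * nu * kap ^+ d.-1)).
  rewrite mulr_natl -[X in _ *+ X](card_ord d) -sumr_const.
  apply: has_integral_sum => k _; rewrite -lamE -mulrA.
  exact: has_integral_local_discrepancy_direction.
have I2 : has_integral mud
    (fun p => \sum_k \sum_l tensor (direction k) p * tensor (direction l) p)
    (d%:R * (nu * kap ^+ d.-1 + (d%:R - 1) * (g ^+ 2 * kap ^+ d.-2))).
  rewrite mulr_natl -[X in _ *+ X](card_ord d) -sumr_const.
  apply: has_integral_sum => k _.
  rewrite (_ : _ + _ = \sum_l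
    (if k == l then nu * kap ^+ d.-1 else g ^+ 2 * kap ^+ d.-2)); last first.
    rewrite (bigD1 k)//= eqxx; congr (_ + _).
    under eq_bigr => j jk do rewrite eq_sym (negbTE jk).
    rewrite sumr_const cardC1 card_ord -[RHS]mulr_natl; congr (_ * _).
    by rewrite -subn1 natrB// (leq_ltn_trans (leq0n k)).
  by apply: has_integral_sum => l _; exact: has_integral_direction2.
have : has_integral mud (fun p =>
    (local_discrepancy p - lam * \sum_k tensor (direction k) p) ^+ 2)
    (v - 2 * lam * (d%:R * (lam * nu * kap ^+ d.-1)) + lam ^+ 2 *
    (d%:R * (nu * kap ^+ d.-1 + (d%:R - 1) * (g ^+ 2 * kap ^+ d.-2)))).
  rewrite (_ : (fun p => _) = (fun p => local_discrepancy p ^+ 2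
    - 2 * lam * (\sum_k local_discrepancy p * tensor (direction k) p)
    + lam ^+ 2 *
      (\sum_k \sum_l tensor (direction k) p * tensor (direction l) p))).
    apply: has_integralD; last by apply: has_integralZ.
    by apply: has_integralB => //; apply: has_integralZ.
  apply/funext => p; rewrite -mulr_sumr.
  under [X in _ + _ * X]eq_bigr do rewrite -mulr_sumr.
  by rewrite -mulr_suml; ring.
move=> /has_integral_ge0 /(_ (fun p => sqr_ge0 _)) v_ge.
by rewrite -subr_ge0; apply: le_trans v_ge _; rewrite le_eqVlt; apply/orP; left;
  apply/eqP; ring.
Qed.

End projection_bound.

(** * One-dimensional Gram matrices *)

Section gram.
Context {R : realType}.
Local Notation T := (measurableTypeR R).
Local Notation mu := (@lebesgue_measure R).
Local Notation mu2 := (@lebesgue_measure R \x @lebesgue_measure R)%E.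

Lemma integral_deriv_poly (p : {poly R}) (b0 b1 : bool) (a b : R) : a <= b ->
  (\int[mu]_(x in [set` Interval (BSide b0 a) (BSide b1 b)]) (p^`().[x])%:E
   = (p.[b] - p.[a])%:E)%E.
Proof.
rewrite le_eqVlt => /predU1P[->|ab].
  rewrite subrr; apply: (@integral_Sset1 _ _ _ b) => x /=.
  by case: b0 b1 => -[]; rewrite in_itv/= => /andP[? ?]; apply/eqP;
    rewrite eq_le; apply/andP; split; lra.
have mf (A : set R) : measurable A ->
    measurable_fun A (fun x => (p^`().[x])%:E).
  move=> mA; apply/measurable_EFinP; apply: measurable_funTS.
  by apply: continuous_measurable_fun; exact: continuous_horner.
rewrite integral_itv_bndoo; last exact: mf.
rewrite -(@integral_itv_bndoo _ a b _ true false); last exact: mf.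
rewrite (@continuous_FTC2 _ (horner p^`()) (horner p))//.
- by apply: continuous_subspaceT; exact: continuous_horner.
- split; first by move=> x _; exact: derivable_horner.
  + by apply: cvg_at_right_filter; exact: continuous_horner.
  + by apply: cvg_at_left_filter; exact: continuous_horner.
- by move=> x _; rewrite derivE.
Qed.

Lemma integral_cubic (c0 c1 c2 c3 : R) (b0 b1 : bool) (a b : R) : a <= b ->
  (\int[mu]_x (if x \in Interval (BSide b0 a) (BSide b1 b)
     then c0 + c1 * x + c2 * x ^+ 2 + c3 * x ^+ 3 else 0)%:E
   = (c0 * (b - a) + c1 / 2 * (b ^+ 2 - a ^+ 2) + c2 / 3 * (b ^+ 3 - a ^+ 3)
      + c3 / 4 * (b ^+ 4 - a ^+ 4))%:E)%E.
Proof.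
move=> ab.
pose p : {poly R} := c0 *: 'X + (c1 / 2) *: 'X^2 + (c2 / 3) *: 'X^3
  + (c3 / 4) *: 'X^4.
transitivity (p.[b] - p.[a])%:E; last first.
  by congr EFin; rewrite /p !hornerE/=; ring.
rewrite -(integral_deriv_poly p b0 b1 ab) [RHS]integral_mkcond.
apply: eq_integral => x _; rewrite /patch mem_setE; case: ifP => // _.
congr EFin; rewrite /p !(poly.derivE, hornerE)/=.
by field.
Qed.

Definition ext_interval (z : R) (p : T * T) : R :=
  if (0 <= p.1 <= z) && (z < p.2 < 1) then 1 else 0.

Definition ext_length (p : T * T) : R :=
  if (0 <= p.1) && (p.1 < p.2 < 1) then p.2 - p.1 else 0.

Lemma measurable_ext_interval z : measurable_fun setT (ext_interval z).
Proof.
have m1 := @measurable_fst _ _ T T; have m2 := @measurable_snd _ _ T T.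
by apply: measurable_fun_ifT => //; apply: measurable_and;
  apply: measurable_and; do ?[exact: measurable_fun_ler|exact: measurable_fun_ltr].
Qed.

Lemma measurable_ext_length : measurable_fun setT ext_length.
Proof.
have m1 := @measurable_fst _ _ T T; have m2 := @measurable_snd _ _ T T.
apply: measurable_fun_ifT => //; last exact: measurable_funB.
by apply: measurable_and; first exact: measurable_fun_ler;
  apply: measurable_and; exact: measurable_fun_ltr.
Qed.

(** Integrands that are quadratic in [y] on [l x .. u x], and whose integral in
[y] is cubic in [x]: this covers every entry of the extreme
Gram matrix.  The boolean arguments say which interval ends are included. *)
Lemma has_integral_nested (f : T * T -> R) (c0 c1 : bool) (a b : R)
    (d0 d1 : bool) (l u q0 q1 q2 : R -> R) (e0 e1 e2 e3 : R) :
  measurable_fun setT f -> (forall p, 0 <= f p) -> a <= b ->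
  let I := Interval (BSide c0 a) (BSide c1 b) in
  (forall x, x \in I -> l x <= u x) ->
  (forall x y, f (x, y) =
    if (x \in I) && (y \in Interval (BSide d0 (l x)) (BSide d1 (u x)))
    then q0 x + q1 x * y + q2 x * y ^+ 2 else 0) ->
  (forall x, x \in I ->
    q0 x * (u x - l x) + q1 x / 2 * (u x ^+ 2 - l x ^+ 2)
    + q2 x / 3 * (u x ^+ 3 - l x ^+ 3)
    = e0 + e1 * x + e2 * x ^+ 2 + e3 * x ^+ 3) ->
  has_integral mu2 f (e0 * (b - a) + e1 / 2 * (b ^+ 2 - a ^+ 2)
    + e2 / 3 * (b ^+ 3 - a ^+ 3) + e3 / 4 * (b ^+ 4 - a ^+ 4)).
Proof.
move=> mf f0 ab I lu fE eE.
refine (@has_integral_tonelli _ _ _ _ _ mu mu f (fun x : R =>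
  if x \in I then e0 + e1 * x + e2 * x ^+ 2 + e3 * x ^+ 3 else 0) _ mf f0 _ _).
  move=> x; under eq_integral do rewrite fE.
  case: ifPn => xI /=; last by rewrite integral0.
  have := integral_cubic (q0 x) (q1 x) (q2 x) 0 d0 d1 (lu x xI).
  rewrite !mul0r addr0 eE// => <-.
  by apply: eq_integral => y _; rewrite mul0r addr0.
exact: integral_cubic.
Qed.

Lemma ext_interval_ge0 z p : 0 <= ext_interval z p.
Proof. by rewrite /ext_interval; case: ifP. Qed.

Lemma ext_length_ge0 p : 0 <= ext_length p.
Proof.
rewrite /ext_length; case: ifP => // /and3P[_ /ltW xy _].
by rewrite subr_ge0.
Qed.

Lemma has_integral_interval_interval z w : 0 <= z < 1 -> 0 <= w < 1 ->
  has_integral mu2 (fun p => ext_interval z p * ext_interval w p)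
    (Num.min z w * (1 - Num.max z w)).
Proof.
move=> /andP[z0 z1] /andP[w0 w1].
have := @has_integral_nested (fun p => ext_interval z p * ext_interval w p)
  true false 0 (Num.min z w) false true (fun=> Num.max z w) (fun=> 1)
  (fun=> 1) (fun=> 0) (fun=> 0) (1 - Num.max z w) 0 0 0.
rewrite (_ : _ * _ + _ + _ + _ = Num.min z w * (1 - Num.max z w)); last by field.
apply => //.
- by apply: measurable_funM; exact: measurable_ext_interval.
- by move=> p; rewrite mulr_ge0// ext_interval_ge0.
- by rewrite le_min z0.
- by move=> x _; rewrite ge_max !ltW.
- move=> x y; rewrite /ext_interval/= !in_itv/= le_min gt_max.
  by case: (0 <= x); case: (x <= z); case: (x <= w); case: (z < y);
    case: (w < y); case: (y < 1) => /=; rewrite ?(mul1r,mul0r,addr0).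
- by move=> x _; field.
Qed.

Lemma has_integral_interval z : 0 <= z < 1 ->
  has_integral mu2 (ext_interval z) (z * (1 - z)).
Proof.
move=> z01; have := has_integral_interval_interval z01 z01.
rewrite minxx maxxx; congr has_integral; apply/funext => p.
by rewrite /ext_interval; case: ifP => _; rewrite (mulr0, mulr1).
Qed.

Lemma has_integral_interval_length z : 0 <= z < 1 ->
  has_integral mu2 (fun p => ext_interval z p * ext_length p) (z * (1 - z) / 2).
Proof.
move=> /andP[z0 z1].
have := @has_integral_nested (fun p => ext_interval z p * ext_length p)
  true false 0 z false true (fun=> z) (fun=> 1)
  (fun x => - x) (fun=> 1) (fun=> 0) ((1 - z ^+ 2) / 2) (z - 1) 0 0.
rewrite (_ : _ * _ + _ + _ + _ = z * (1 - z) / 2); last by field.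
apply => //.
- apply: measurable_funM; first exact: measurable_ext_interval.
  exact: measurable_ext_length.
- by move=> p; rewrite mulr_ge0// (ext_interval_ge0, ext_length_ge0).
- by move=> x _; rewrite ltW.
- move=> x y; rewrite /ext_interval /ext_length/= !in_itv/=.
  case: ifPn => [/andP[/andP[x0 xz] /andP[zy y1]]|_]; last by rewrite mul0r.
  by rewrite x0 y1 (le_lt_trans xz)//=; ring.
- by move=> x _; field.
Qed.

Lemma has_integral_length_length :
  has_integral mu2 (fun p => ext_length p * ext_length p) 12^-1.
Proof.
have := @has_integral_nested (fun p => ext_length p * ext_length p)
  true true 0 1 false true id (fun=> 1)
  (fun x => x ^+ 2) (fun x => - 2 * x) (fun=> 1) 3^-1 (- 1) 1 (- 3^-1).
rewrite (_ : _ * _ + _ + _ + _ = 12^-1); last by field.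
apply => //.
- by apply: measurable_funM; exact: measurable_ext_length.
- by move=> p; rewrite mulr_ge0// ext_length_ge0.
- by move=> x; rewrite in_itv/= => /andP[_ /ltW].
- move=> x y; rewrite /ext_length/= !in_itv/=.
  have [x0|x0] := boolP (0 <= x); last by rewrite mul0r.
  case: (boolP (x < y < 1)) => [/andP[xy y1]|_]; last first.
    by rewrite mul0r andbF.
  by rewrite (lt_trans xy y1)/=; ring.
- by move=> x _; field.
Qed.

Lemma has_integral_length : has_integral mu2 ext_length 6^-1.
Proof.
have := @has_integral_nested ext_length
  true true 0 1 false true id (fun=> 1)
  (fun x => - x) (fun=> 1) (fun=> 0) 2^-1 (- 1) 2^-1 0.
rewrite (_ : _ * _ + _ + _ + _ = 6^-1); last by field.
apply => //.
- exact: measurable_ext_length.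
- by move=> p; rewrite ext_length_ge0.
- by move=> x; rewrite in_itv/= => /andP[_ /ltW].
- move=> x y; rewrite /ext_length/= !in_itv/=.
  have [x0|x0] := boolP (0 <= x) => //.
  case: (boolP (x < y < 1)) => [/andP[xy y1]|_]; last by rewrite !andbF.
  by rewrite (lt_trans xy y1)/=; ring.
- by move=> x _; field.
Qed.

Definition below_diagonal (p : T * T) : R :=
  if (0 <= p.2 <= p.1) && (p.1 < 1) then 1 else 0.

Lemma has_integral_below_diagonal : has_integral mu2 below_diagonal 2^-1.
Proof.
have m1 := @measurable_fst _ _ T T; have m2 := @measurable_snd _ _ T T.
have := @has_integral_nested below_diagonal
  true true 0 1 true false (fun=> 0) id
  (fun=> 1) (fun=> 0) (fun=> 0) 0 1 0 0.
rewrite (_ : _ * _ + _ + _ + _ = 2^-1); last by field.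
apply => //.
- by apply: measurable_fun_ifT => //; apply: measurable_and;
    [apply: measurable_and; exact: measurable_fun_ler|exact: measurable_fun_ltr].
- by move=> p; rewrite /below_diagonal; case: ifP.
- by move=> x; rewrite in_itv/= => /andP[].
- move=> x y; rewrite /below_diagonal/= !in_itv/= !mul0r !addr0.
  have [y0|_] := boolP (0 <= y); last by rewrite andbF.
  case: (boolP (y <= x)) => [yx|_]; last by rewrite !andbF.
  by rewrite (le_trans y0 yx) !andbT.
- by move=> x _; field.
Qed.

(** Turns the extreme version of a function of an interval into the periodic
one: when [y <= x] the periodic interval is the complement in [[0, 1)] of the
interval from [y] to [x], which has value [1 - f (y, x)]. *)
Definition periodized (f : T * T -> R) (p : T * T) : R :=
  f p + below_diagonal p - f (p.2, p.1).

Definition supported_upper (f : T * T -> R) : Prop :=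
  forall p, ~~ [&& 0 <= p.1, p.1 < p.2 & p.2 < 1] -> f p = 0.

(** On [x < y] the product is [f * g]; on [y <= x] it is
[(1 - f) * (1 - g)] at [(y, x)], expanded below. *)
Lemma has_integral_periodized f g u v w :
  supported_upper f -> supported_upper g ->
  (forall p, 0 <= f p) -> (forall p, 0 <= g p) ->
  has_integral mu2 (fun p => f p * g p) u ->
  has_integral mu2 f v -> has_integral mu2 g w ->
  has_integral mu2 (fun p => periodized f p * periodized g p)
    (2 * u + 2^-1 - v - w).
Proof.
move=> sf sg f0 g0 fg fv gw.
rewrite (_ : 2 * u + 2^-1 - v - w = u + (2^-1 - v - w + u)); last by ring.
rewrite (_ : (fun p => _) = (fun p => f p * g p +
   (below_diagonal p - f (p.2, p.1) - g (p.2, p.1) + f (p.2, p.1) * g (p.2, p.1)))).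
  apply: has_integralD => //; apply: has_integralD; last first.
    apply: (has_integral_swap (f := fun p => f p * g p)) => // p.
    exact: mulr_ge0.
  apply: has_integralB; last exact: has_integral_swap.
  apply: has_integralB; last exact: has_integral_swap.
  exact: has_integral_below_diagonal.
apply/funext => -[x y]; rewrite /periodized /below_diagonal/=.
case: ifPn => [/andP[/andP[y0 yx] x1]|].
  rewrite (sf (x, y)) ?(sg (x, y))/= ?(ltNge x y) ?yx ?andbF//; ring.
move=> yx; rewrite (sf (y, x)) ?(sg (y, x))/=.
- ring.
- by apply: contra yx => /and3P[-> /ltW -> ->].
- by apply: contra yx => /and3P[-> /ltW -> ->].
Qed.

Lemma supported_ext_interval z : 0 <= z < 1 -> supported_upper (ext_interval z).
Proof.
move=> /andP[z0 z1] [x y]; rewrite /ext_interval/=; case: ifPn => //.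
move=> /andP[/andP[-> xz] /andP[zy ->]].
by rewrite (le_lt_trans xz zy).
Qed.

Lemma supported_ext_length : supported_upper ext_length.
Proof. by move=> p; rewrite /ext_length; case: ifPn. Qed.

End gram.

(** * Sums over the grid *)

Section grid_sums.
Context {R : realType}.

Lemma sum_natr (M : nat) : \sum_(j < M) (j%:R : R) = M%:R * (M%:R - 1) / 2.
Proof.
elim: M => [|M IHM]; first by rewrite big_ord0 !mul0r.
by rewrite big_ord_recr/= IHM -natr1; field.
Qed.

Lemma sum_natr_sq (M : nat) :
  \sum_(j < M) (j%:R ^+ 2 : R) = M%:R * (M%:R - 1) * (2 * M%:R - 1) / 6.
Proof.
elim: M => [|M IHM]; first by rewrite big_ord0 !mul0r.
by rewrite big_ord_recr/= IHM -natr1; field.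
Qed.

(** The upper bound is written [h + k] so that the proof is an induction on the
number [k] of terms beyond the kink at [h]. *)
Lemma sum_tent (h k : nat) (m : R) :
  \sum_(j < h + k)
    (if (j <= h)%N then j%:R * (m - h%:R) else h%:R * (m - j%:R))
  = h%:R * (h%:R - 1) / 2 * (m - h%:R)
    + h%:R * (k%:R * (m - h%:R) - k%:R * (k%:R - 1) / 2).
Proof.
elim: k => [|k IHk].
  rewrite addn0 (eq_bigr (fun j : 'I_h => j%:R * (m - h%:R))) => [|j _].
    by rewrite -mulr_suml sum_natr; field.
  by rewrite ltnW.
rewrite addnS big_ord_recr/= IHk -natr1; case: leqP => [hk|_]; last first.
  by rewrite natrD; field.
have -> : k = 0%N by apply/eqP; rewrite -leqn0 -(leq_add2l h) addn0.
by rewrite addn0; field.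
Qed.

Definition grid (M : nat) (i : nat) : R := i%:R / M%:R.

Lemma grid_itv M (i : 'I_M) : 0 <= grid M i < 1.
Proof.
have M0 : (0 < M)%N by apply: leq_ltn_trans (ltn_ord i).
by rewrite /grid divr_ge0//= ltr_pdivrMr ?ltr0n// mul1r ltr_nat.
Qed.

Lemma sum_grid_var M : (0 < M)%N ->
  \sum_(i < M) grid M i * (1 - grid M i) = M%:R / 6 - (6 * M%:R)^-1.
Proof.
move=> M0; have Mn0 : M%:R != 0 :> R by rewrite pnatr_eq0 -lt0n.
transitivity ((\sum_(i < M) i%:R : R) / M%:R
    - (\sum_(i < M) i%:R ^+ 2 : R) / M%:R ^+ 2).
  rewrite !mulr_suml -sumrB; apply: eq_bigr => i _.
  by rewrite /grid; field.
by rewrite sum_natr sum_natr_sq; field.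
Qed.

(** This says that the grid discrepancy is orthogonal, over [x < y], to the
indicator of every grid point: the right-hand side is [M] times the product of
that indicator with the length. *)
Lemma sum_grid_minmax M (i : 'I_M) :
  \sum_(j < M) Num.min (grid M i) (grid M j) * (1 - Num.max (grid M i) (grid M j))
  = M%:R * (grid M i * (1 - grid M i) / 2).
Proof.
have M0 : (0 < M)%N by apply: leq_ltn_trans (ltn_ord i).
have Mn0 : M%:R != 0 :> R by rewrite pnatr_eq0 -lt0n.
have iM := ltnW (ltn_ord i).
transitivity (\sum_(j < i + (M - i)) (if (j <= i)%N then j%:R * (M%:R - i%:R)
    else i%:R * (M%:R - j%:R) : R) / M%:R ^+ 2).
  rewrite subnKC//; apply: eq_bigr => j _.
  have gridE (a b : nat) : (grid M a <= grid M b) = (a <= b)%N.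
    by rewrite ler_pM2r ?invr_gt0 ?ltr0n// ler_nat.
  case: ifPn => [ji|].
    rewrite min_r ?gridE// max_l ?gridE//; rewrite /grid; field.
    exact: Mn0.
  rewrite -ltnNge => /ltnW ij.
  rewrite min_l ?gridE// max_r ?gridE//; rewrite /grid; field.
  exact: Mn0.
by rewrite -mulr_suml sum_tent natrB// /grid; field.
Qed.

End grid_sums.

Section discrepancy_bounds.
Context {R : realType}.
Local Notation T := (measurableTypeR R).
Variables (M d : nat) (H : {set d.-tuple 'I_M}).
Hypothesis M0 : (0 < M)%N.
Local Notation mud := (lebesgue_tuple R d \x lebesgue_tuple R d)%E.

Let interval (i : 'I_M) : T * T -> R := ext_interval (grid M i).

(** Here [a = 0], [kap = 1 / 12] and [g = - 1 / (12 M)]. *)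
Lemma ext_discrepancy_sq : exists2 v : R,
  has_integral mud (fun p => local_discrepancy H interval ext_length p ^+ 2) v &
  (#|H|%:R / M%:R) ^+ 2 * (d%:R * 12^-1 * 12^-1 ^+ d.-1
     - d%:R * (d%:R - 1) * (12 * M%:R)^-1 ^+ 2 * 12^-1 ^+ d.-2) <= v.
Proof.
have Mn0 : M%:R != 0 :> R by rewrite pnatr_eq0 -lt0n.
have AA i j : has_integral _ (fun p => interval i p * interval j p) _ :=
  has_integral_interval_interval (grid_itv i) (grid_itv j).
have AL i : has_integral _ (fun p => interval i p * ext_length p) _ :=
  has_integral_interval_length (grid_itv i).
have LL := @has_integral_length_length R.
have [v vP] := has_integral_local_discrepancy_sq H AA AL LL.
exists v => //.
have rowG (i : 'I_M) : \sum_(j < M) Num.min (grid M i) (grid M j)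
    * (1 - Num.max (grid M i) (grid M j))
    - M%:R * (grid M i * (1 - grid M i) / 2) = 0 :> R.
  by rewrite sum_grid_minmax subrr.
have := local_discrepancy_sq_ge AA AL LL rowG (or_introl (erefl _)) M0 vP.
rewrite -mulr_suml sum_grid_var//; set c := _ - _ * 12^-1.
have -> : c = - (12 * M%:R)^-1 by rewrite /c; field.
rewrite (_ : M%:R * _ = 12^-1) ?sqrrN//.
by field.
Qed.

(** Here [a = 1 / (6 M)], [b i = kap = 1 / 3] and [g = 0]. *)
Lemma per_discrepancy_sq : exists2 v : R,
  has_integral mud (fun p => local_discrepancy H
    (fun i => periodized (interval i)) (periodized ext_length) p ^+ 2) v &
  (#|H|%:R / M%:R) ^+ 2 * (d%:R * 6^-1 * 3^-1 ^+ d.-1) <= v.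
Proof.
have Mn0 : M%:R != 0 :> R by rewrite pnatr_eq0 -lt0n.
have sA (i : 'I_M) : supported_upper (interval i) :=
  supported_ext_interval (grid_itv i).
have sL := @supported_ext_length R.
have A0 i p : 0 <= interval i p := ext_interval_ge0 _ _.
have L0 := @ext_length_ge0 R.
have A1 (i : 'I_M) : has_integral _ (interval i) _ :=
  has_integral_interval (grid_itv i).
have L1 := @has_integral_length R.
have AA (i j : 'I_M) := has_integral_periodized (sA i) (sA j) (A0 i) (A0 j)
  (has_integral_interval_interval (grid_itv i) (grid_itv j)) (A1 i) (A1 j).
have AL (i : 'I_M) := has_integral_periodized (sA i) sL (A0 i) L0
  (has_integral_interval_length (grid_itv i)) (A1 i) L1.
have LL := has_integral_periodized sL sL L0 L0
  (@has_integral_length_length R) L1 L1.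
have [v vP] := has_integral_local_discrepancy_sq H AA AL LL.
exists v => //.
pose var (i : 'I_M) : R := grid M i * (1 - grid M i).
pose b i := 2 * (var i / 2) + 2^-1 - var i - 6^-1.
have bE i : b i = 3^-1 by rewrite /b; field.
pose kap : R := 2 * 12^-1 + 2^-1 - 6^-1 - 6^-1.
have kapE : kap = 3^-1 by rewrite /kap; field.
pose G (i j : 'I_M) : R := 2 * (Num.min (grid M i) (grid M j)
  * (1 - Num.max (grid M i) (grid M j))) + 2^-1 - var i - var j.
have cst (c : R) : \sum_(j < M) c = M%:R * c.
  by rewrite sumr_const card_ord mulr_natl.
have rowG i : \sum_(j < M) G i j - M%:R * b i = (6 * M%:R)^-1.
  rewrite bE /G sumrB sum_grid_var// sumrB big_split/= -mulr_sumr.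
  rewrite sum_grid_minmax !cst /var.
  by field.
have := @local_discrepancy_sq_ge _ _ _ H _ _ G b kap AA AL LL _ rowG
  (or_intror _) _ M0 vP.
have -> : \sum_(i < M) b i - M%:R * kap = 0.
  under eq_bigr do rewrite bE.
  by rewrite cst kapE subrr.
rewrite kapE subr0 expr0n mulr0 mul0r subr0 (_ : M%:R * _ = 6^-1); last by field.
by apply=> i; rewrite bE.
Qed.

End discrepancy_bounds.

(** * Point sets of weak Latin hypercubes *)

(** Deleting the first coordinate maps [H] bijectively onto the tuples of
length [d]. *)
Lemma card_weak_latin_hypercube (d M : nat) (H : {set d.+1.-tuple 'I_M}) :
  (0 < M)%N -> weak_latin_hypercube H -> #|H| = (M ^ d)%N.
Proof.
move=> M0 latin.
pose tail (h : d.+1.-tuple 'I_M) : d.-tuple 'I_M := [tuple of behead h].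
have lineE j m : [tuple if i == ord0 then j else tnth m i | i < d.+1]
    = cons_tuple j (tail m).
  apply: eq_from_tnth => i; rewrite tnth_mktuple.
  case: (unliftP ord0 i) => [k ->|->]; last by rewrite eqxx.
  by rewrite eq_sym (negbTE (neq_lift _ _)) [in LHS](tuple_eta m) !tnthS.
have tailK h : cons_tuple (thead h) (tail h) = h.
  by rewrite [RHS]tuple_eta; exact: val_inj.
have tail_cons j t : tail (cons_tuple j t) = t by exact: val_inj.
have tail_inj : {in H &, injective tail}.
  move=> h h' hH h'H hh'; have [j [_ juniq]] := latin ord0 h.
  rewrite -(tailK h) -(tailK h') -hh'.
  rewrite -(juniq (thead h)) ?lineE ?tailK// -(juniq (thead h')) ?lineE//.
  by rewrite hh' tailK.
rewrite -[M in RHS]card_ord -card_tuple -cardsT -(card_in_imset tail_inj).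
apply: eq_card => t; rewrite inE; apply/imsetP.
have [j [jH _]] := latin ord0 (cons_tuple (Ordinal M0) t).
by exists (cons_tuple j t); rewrite ?tail_cons//; move: jH; rewrite lineE tail_cons.
Qed.

Section link.
Context {R : realType}.
Local Notation T := (measurableTypeR R).
Variables (M d : nat) (H : {set d.-tuple 'I_M}).
Hypothesis M0 : (0 < M)%N.
Local Notation mud := (lebesgue_tuple R d \x lebesgue_tuple R d)%E.

Let point (h : d.-tuple 'I_M) : d.-tuple R := [tuple grid M (tnth h i) | i < d].

Lemma point_inj : injective point.
Proof.
move=> h h' /(congr1 (fun t => tnth t _)) hh'; apply: eq_from_tnth => i.
have := hh' i; rewrite !tnth_mktuple /grid => /mulIf.
rewrite invr_eq0 pnatr_eq0 -lt0n => /(_ M0)/eqP.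
by rewrite eqr_nat => /eqP/val_inj.
Qed.

Lemma card_latin_points : #|` @latin_points R _ _ H|%fset = #|H|.
Proof. by rewrite card_imfset/= -?cardE//; exact: point_inj. Qed.

Lemma card_latin_points_in (P : pred (d.-tuple R)) :
  #|` [fset z in latin_points H | P z]|%fset = (\sum_(h in H) P (point h))%N.
Proof.
have -> : [fset z in latin_points H | P z]%fset =
    [fset point h | h : d.-tuple 'I_M in [set h in H | P (point h)]%SET]%fset.
  apply/fsetP => z; rewrite !inE/=; apply/andP/imfsetP => /=.
    move=> [/imfsetP[h /= hH ->] Pz]; exists h => //.
    by rewrite inE hH.
  move=> [h]; rewrite inE => /andP[hH Ph] ->; split=> //.
  by apply/imfsetP; exists h.
rewrite card_imfset/= -?cardE; last exact: point_inj.
rewrite -sum1_card big_mkcond [RHS]big_mkcond/=; apply: eq_bigr => h _.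
by rewrite inE; case: (h \in H); case: (P _).
Qed.

Lemma discrepancyE (f : 'I_M -> T * T -> R) (L : T * T -> R)
    (x y : d.-tuple R) :
  @cube R d x -> @cube R d y ->
  (forall i k, f i (tnth x k, tnth y k) =
    ((grid M i) \in periodic_itv (tnth x k) (tnth y k))%:R) ->
  (forall k, L (tnth x k, tnth y k) = if tnth x k < tnth y k
    then tnth y k - tnth x k else 1 - tnth x k + tnth y k) ->
  discrepancy (latin_points H) x y = local_discrepancy H f L (x, y).
Proof.
move=> cx cy fE LE; rewrite /discrepancy /local_discrepancy volumeE//.
rewrite card_latin_points card_latin_points_in natr_sum; congr (_ - _ * _).
  apply: eq_bigr => h _; rewrite /tensor/=.
  under eq_bigr do rewrite fE.
  have [zb|zb] := boolP (point h \in periodic_box x y).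
    rewrite big1// => k _; apply/eqP; rewrite pnatr_eq1 eqb1; apply/mem_set.
    by have := set_mem zb k; rewrite tnth_mktuple.
  apply/esym/eqP; rewrite prodf_seq_eq0; apply/hasP.
  have /existsNP[k zk] : ~ forall k,
      periodic_itv (tnth x k) (tnth y k) (tnth (point h) k).
    by move=> zb'; move/negP: zb; apply; exact/mem_set.
  exists k; first exact: mem_index_enum.
  rewrite /= pnatr_eq0 eqb0; apply/negP => /set_mem.
  by rewrite -(tnth_mktuple (fun k => grid M (tnth h k))).
by rewrite /tensor; apply: eq_bigr => k _; rewrite LE.
Qed.

(** Passes from integrals restricted to a domain to the integral over all pairs
of a function vanishing off that domain, to which Tonelli applies. *)
Lemma iterated_integral_sq (F G : d.-tuple T -> d.-tuple T -> R)
    (D1 : set (d.-tuple T)) (D2 : d.-tuple T -> set (d.-tuple T)) (v : R) :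
  has_integral mud (fun p => G p.1 p.2 ^+ 2) v ->
  (forall x y, D1 x -> D2 x y -> F x y = G x y) ->
  (forall x y, ~ (D1 x /\ D2 x y) -> G x y = 0) ->
  (\int[lebesgue_tuple R d]_(x in D1) \int[lebesgue_tuple R d]_(y in D2 x)
     ((F x y ^+ 2)%R)%:E = v%:E)%E.
Proof.
move=> Gv FG G0; rewrite -(has_integral_iterated Gv); last first.
  by move=> p; exact: sqr_ge0.
rewrite integral_mkcond; apply: eq_integral => x _; rewrite /patch.
case: ifPn => [/set_mem xD|xD]; last first.
  rewrite integral0_eq// => y _; rewrite G0 ?expr0n//.
  by move=> [xD1 _]; move/negP: xD; apply; exact/mem_set.
rewrite integral_mkcond; apply: eq_integral => y _; rewrite /patch.
case: ifPn => [/set_mem yD|yD]; first by rewrite FG.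
by rewrite G0 ?expr0n// => -[_ yD1]; move/negP: yD; apply; exact/mem_set.
Qed.

Lemma local_discrepancy_eq0 (f : 'I_M -> T * T -> R) (L : T * T -> R) x y k :
  (forall i, f i (tnth x k, tnth y k) = 0) -> L (tnth x k, tnth y k) = 0 ->
  local_discrepancy H f L (x, y) = 0.
Proof.
move=> f0 L0; rewrite /local_discrepancy /tensor big1 => [|h _].
  by rewrite (bigD1 k)//= L0 mul0r mulr0 subr0.
by rewrite (bigD1 k)//= f0 mul0r.
Qed.

End link.

(** * Lower bounds for the discrepancies *)

Section L2.
Context {R : realType}.
Local Notation T := (measurableTypeR R).

Lemma ext_interval_periodic_itv (z x y : R) :
  0 <= x < 1 -> 0 <= y < 1 -> 0 <= z < 1 -> x < y ->
  ext_interval z (x, y) = (z \in periodic_itv x y)%:R.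
Proof.
move=> /andP[x0 x1] /andP[y0 y1] z01 xy.
rewrite /ext_interval/= x0 y1 andbT /=.
suff -> : (z \in periodic_itv x y) = (x <= z) && (z < y) by case: (_ && _).
rewrite /periodic_itv xy; apply/idP/idP; first by move=> /set_mem[].
by move=> xzy; apply/mem_set.
Qed.

Lemma periodized_interval_periodic_itv (z x y : R) :
  0 <= x < 1 -> 0 <= y < 1 -> 0 <= z < 1 ->
  periodized (ext_interval z) (x, y) = (z \in periodic_itv x y)%:R.
Proof.
move=> x01 y01 z01; have /andP[x0 x1] := x01; have /andP[y0 y1] := y01.
rewrite /periodized /below_diagonal/=; have [xy|yx] := ltP x y.
  rewrite ext_interval_periodic_itv// /ext_interval/= andbF/=.
  case: ifPn => [/andP[/andP[_ yz] /andP[zx _]]|_]; last by rewrite addr0 subr0.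
  by have := lt_trans (le_lt_trans yz zx) xy; rewrite ltxx.
rewrite y0 x1 /ext_interval/= x0 y1 y0 x1 !andbT/=.
have -> : (x <= z) && (z < y) = false.
  by apply/negP => /andP[xz zy]; have := lt_le_trans (le_lt_trans xz zy) yx;
    rewrite ltxx.
have -> : (z \in periodic_itv x y) = ~~ ((y <= z) && (z < x)).
  rewrite /periodic_itv ltNge yx/=; apply/idP/idP.
    by move=> /set_mem[_ [xz|zy]]; rewrite -?leNgt negb_and -?ltNge -?leNgt
      ?xz ?zy ?orbT.
  rewrite negb_and -ltNge -leNgt => /orP h; apply/mem_set; split=> //.
  by case: h; [right|left].
by rewrite add0r; case: (_ && _); rewrite ?subrr ?subr0.
Qed.

Lemma periodized_length (x y : R) : 0 <= x < 1 -> 0 <= y < 1 ->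
  periodized ext_length (x, y) = if x < y then y - x else 1 - x + y.
Proof.
move=> /andP[x0 x1] /andP[y0 y1].
rewrite /periodized /below_diagonal /ext_length/= x0 x1 y0 y1 !andbT/=.
by case: ltgtP => [_|_|->]; ring.
Qed.

Lemma periodized_eq0 f (x y : R) : supported_upper f ->
  ~~ ((0 <= x < 1) && (0 <= y < 1)) -> periodized f (x, y) = 0.
Proof.
move=> sf xy; rewrite /periodized /below_diagonal/= !sf/= ?subr0 ?add0r.
- case: ifPn => // /andP[/andP[y0 yx] x1]; case/negP: xy.
  by rewrite (le_trans y0 yx) x1 y0 (le_lt_trans yx x1).
- apply: contra xy => /and3P[y0 yx x1].
  by rewrite x1 y0 (le_trans y0 (ltW yx)) (lt_trans yx x1).
- apply: contra xy => /and3P[x0 xy y1].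
  by rewrite x0 y1 (le_trans x0 (ltW xy)) (lt_trans xy y1).
Qed.

Variables (M d : nat) (H : {set d.-tuple 'I_M}).
Hypothesis M0 : (0 < M)%N.
Let X : {fset d.-tuple R} := latin_points H.

Lemma L2per_ge (c : R) : 0 <= c ->
  c ^+ 2 <= (#|H|%:R / M%:R) ^+ 2 * (d%:R * 6^-1 * 3^-1 ^+ d.-1) ->
  c <= L2per X.
Proof.
move=> c0 cle; have [v vP vge] := @per_discrepancy_sq R M d H M0.
rewrite /L2per (_ : fine _ = v); last first.
  rewrite -[RHS]/(fine v%:E); congr fine.
  apply: (@iterated_integral_sq _ _ _ (fun x y => local_discrepancy H
    (fun i => periodized (ext_interval (grid M i))) (periodized ext_length) (x, y))
    _ (fun=> @cube R d)) => [|x y cx cy|x y nxy].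
  - by under eq_fun do rewrite -surjective_pairing.
  - apply: discrepancyE => // [i k|k].
      apply: periodized_interval_periodic_itv; [exact: cx|exact: cy|].
      exact: grid_itv.
    apply: periodized_length; [exact: cx|exact: cy].
  - have [k nk] : exists k, ~~ ((0 <= tnth x k < 1) && (0 <= tnth y k < 1)).
    apply: contrapT => /forallNP nk; apply: nxy.
    by split=> k; have := nk k; move/negP; rewrite negbK => /andP[].
  apply: (@local_discrepancy_eq0 _ _ _ _ _ _ _ _ k) => [i|].
    exact: (periodized_eq0 (supported_ext_interval (grid_itv i)) nk).
  exact: (periodized_eq0 (@supported_ext_length R) nk).
by rewrite -(ger0_norm c0) -sqrtr_sqr ler_wsqrtr// (le_trans cle).
Qed.

Lemma L2extr_ge (c : R) : 0 <= c ->
  c ^+ 2 <= (#|H|%:R / M%:R) ^+ 2 * (d%:R * 12^-1 * 12^-1 ^+ d.-1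
     - d%:R * (d%:R - 1) * (12 * M%:R)^-1 ^+ 2 * 12^-1 ^+ d.-2) ->
  c <= L2extr X.
Proof.
move=> c0 cle; have [v vP vge] := @ext_discrepancy_sq R M d H M0.
rewrite /L2extr (_ : fine _ = v); last first.
  rewrite -[RHS]/(fine v%:E); congr fine.
  apply: (@iterated_integral_sq _ _ _ (fun x y => local_discrepancy H
    (fun i => ext_interval (grid M i)) ext_length (x, y)) _
    (fun x => [set y | @cube R d y /\
       forall k, (tnth x k < tnth y k :> R)%R])) => [|x y cx [cy xy]|x y nxy].
  - by under eq_fun do rewrite -surjective_pairing.
  - apply: discrepancyE => // [i k|k].
      apply: ext_interval_periodic_itv; [exact: cx|exact: cy| |exact: xy].
      exact: grid_itv.
    rewrite xy /ext_length/= xy; have /andP[-> _] := cx k.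
    by have /andP[_ ->] := cy k.
  - have [k nk] : exists k,
      ~~ [&& 0 <= tnth x k, tnth x k < tnth y k & tnth y k < 1].
    apply: contrapT => /forallNP nk; apply: nxy.
    have {}nk k : [&& 0 <= tnth x k, tnth x k < tnth y k & tnth y k < 1].
      by have := nk k; move/negP; rewrite negbK.
    split=> [k|]; first have /and3P[x0 xy y1] := nk k.
      by rewrite x0 (lt_trans xy y1).
    split=> k; have /and3P[x0 xy y1] := nk k => //.
    by rewrite y1 (le_trans x0 (ltW xy)).
  apply: (@local_discrepancy_eq0 _ _ _ _ _ _ _ _ k) => [i|].
    by apply: supported_ext_interval; [exact: grid_itv|exact: nk].
  by apply: supported_ext_length; exact: nk.
by rewrite -(ger0_norm c0) -sqrtr_sqr ler_wsqrtr// (le_trans cle).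
Qed.

End L2.

Lemma powR_inv_natr_cvg0 (R : realType) (r : R) : 0 < r ->
  (n%:R^-1 `^ r : R) @[n --> \oo] --> (0 : R).
Proof.
move=> r0.
have inv0 : (n%:R^-1 : R) @[n --> \oo] --> (0 : R)^'+.
  move=> A [e /= e0 eA].
  have inv0 : (fun n : nat => n%:R^-1 : R) @ \oo --> (0 : R).
    exact: ((gtr0_cvgV0 (nbhs_infty_gtr 0)).2 cvgr_idn).
  have [k _ kA] : \forall n \near \oo, `|n%:R^-1 : R| < e.
    exact: cvgr0_norm_lt.
  exists k.+1 => // n /= kn; apply: eA; last first.
    by rewrite invr_gt0 ltr0n (leq_ltn_trans _ kn).
  by rewrite /ball/= sub0r normrN; apply: kA; exact: ltnW.
exact: (cvg_comp _ _ inv0 (powR_cvg0 r0)).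
Qed.

Theorem theorem3p7 (R : realType) (d : nat) (hd : (2 <= d)%N) :
  exists o : nat -> R, o n @[n --> \oo] --> (0 : R) /\
    forall (M : nat) (H : {set d.-tuple 'I_M}),
      (1 <= M)%N -> weak_latin_hypercube H ->
      let X : {fset d.-tuple R} := latin_points H in
      let N : nat := #|` X |%fset in
      [/\ N = (M ^ (d - 1))%N,
          L2per X >= Num.sqrt (d%:R / (2 * 3 ^+ d))
                     * N%:R `^ ((d%:R - 2) / (d%:R - 1)) &
          L2extr X >= Num.sqrt (d%:R / 12 ^+ d) * (1 - o N)
                      * N%:R `^ ((d%:R - 2) / (d%:R - 1))].
Proof.
case: d hd => [//|[//|d]] _.
(* For [N = M ^ d.+1] this is the relative loss [d.+1 / M ^ 2] coming from the
   cross terms of the test function. *)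
exists (fun n => d.+1%:R * n%:R^-1 `^ (2 / d.+1%:R)); split.
  rewrite -(mulr0 d.+1%:R); apply: cvgMl_tmp.
  by apply: powR_inv_natr_cvg0; rewrite divr_gt0// ltr0n.
move=> M H M0 latin X N.
have Mn0 : M%:R != 0 :> R by rewrite pnatr_eq0 -lt0n.
have HE : #|H| = (M ^ d.+1)%N := card_weak_latin_hypercube M0 latin.
have NE : N = (M ^ d.+1)%N by rewrite /N card_latin_points.
have NR : N%:R = M%:R `^ d.+1%:R :> R by rewrite NE natrX powR_mulrn.
have ratioE : #|H|%:R / M%:R = M%:R ^+ d :> R by rewrite HE natrX exprSr mulfK.
have -> : N%:R `^ ((d.+2%:R - 2) / (d.+2%:R - 1)) = M%:R ^+ d :> R.
  rewrite (_ : _ / _ = d%:R / d.+1%:R); last first.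
    by rewrite -(natrB _ (isT : (2 <= d.+2)%N)) -(natrB _ (isT : (1 <= d.+2)%N))
      !subSS !subn0.
  by rewrite NR -powRrM mulrCA divff ?pnatr_eq0// mulr1 powR_mulrn.
have oE : N%:R^-1 `^ (2 / d.+1%:R) = M%:R^-1 ^+ 2 :> R.
  have -> : N%:R^-1 = M%:R^-1 `^ d.+1%:R :> R.
    by rewrite NE natrX -exprVn powR_mulrn.
  by rewrite -powRrM mulrC divfK ?pnatr_eq0// powR_mulrn.
split.
- by rewrite NE subn1.
- apply: L2per_ge => //.
  rewrite exprMn sqr_sqrtr; last by rewrite divr_ge0// mulr_ge0// exprn_ge0.
  rewrite ratioE mulrC le_eqVlt; apply/orP; left; apply/eqP; congr (_ * _).
  by rewrite /= exprS exprVn; field; rewrite expf_neq0.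
rewrite oE; set t := 1 - _.
have [t0|t0] := leP t 0.
  apply: le_trans (sqrtr_ge0 _).
  by rewrite mulr_le0_ge0// mulr_ge0_le0// sqrtr_ge0.
have t1 : t <= 1 by rewrite /t gerBl mulr_ge0// sqr_ge0.
apply: L2extr_ge => //; first by rewrite !mulr_ge0// ?sqrtr_ge0// ltW.
rewrite ratioE 2!exprMn sqr_sqrtr; last by rewrite divr_ge0// exprn_ge0.
rewrite mulrC ler_wpM2l ?sqr_ge0//.
apply: (@le_trans _ _ (d.+2%:R / 12 ^+ d.+2 * t)).
  by rewrite ler_wpM2l ?divr_ge0 ?exprn_ge0// expr2 ler_piMl// ltW.
rewrite le_eqVlt; apply/orP; left; apply/eqP; rewrite /t/=.
have -> : d.+2%:R - 1 = d.+1%:R :> R by rewrite -(natr1 d.+1) addrK.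
rewrite !exprS !exprVn; field.
by rewrite expf_neq0// Mn0.
Qed.
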